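(* For every integer $i\ge 1$, the generalized Blanuša snark $B_i^1$ of the first family satisfies $\tau(B_i^1)=\left\lceil \frac{14i+17}{3}\right\rceil$.
   Context: All graphs are simple, finite and undirected. $\tau(G)$ denotes the vertex cover number of $G$, i.e., the minimum cardinality of a set $C\subseteq V(G)$ such that every edge of $G$ has at least one endpoint in $C$. The building block $A_1$ is the graph with vertex set $\{a,b,c,d,e,f,g,h,i,j\}$ (here $i$ and $j$ are names of vertices, not integers) and edge set $\{af,\,fh,\,hc,\,ei,\,bg,\,gj,\,jd,\,ae,\,eb,\,fg,\,hi,\,ij,\,cd\}$. For each integer $k\ge 1$, the building block $L_k$ is the graph with vertex set $\{x_k,y_k,w_k,z_k,u_k,v_k,s_k,t_k\}$ and edge set $\{x_kv_k,\,v_kw_k,\,u_kt_k,\,y_ks_k,\,s_kz_k,\,x_ku_k,\,u_ky_k,\,v_ks_k,\,w_kt_k,\,t_kz_k\}$. All blocks are vertex-disjoint. For an integer $i\ge 1$, the generalized Blanuša snark $B_i^1$ of the first family has vertex set $V(A_1)\cup\bigcup_{k=1}^i V(L_k)$ and edge set $$E(A_1)\cup\left(\bigcup_{k=1}^i E(L_k)\right)\cup\{z_kx_{k+1},\,w_ky_{k+1}\mid 1\le k\le i-1\}\cup\{y_1c,\,x_1d,\,z_ia,\,w_ib\}.$$ *)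

(* Defs.v *)
From HB Require Import structures.
From mathcomp Require Import all_boot.

Set Implicit Arguments.
Unset Strict Implicit.
Unset Printing Implicit Defensive.

Record sgraph := SGraph {
  vertex :> finType;
  adj : rel vertex;
  adj_sym : symmetric adj;
  adj_irrefl : irreflexive adj }.

Definition vertex_cover (G : sgraph) (C : {set G}) : bool :=
  [forall x : G, forall y : G, adj x y ==> (x \in C) || (y \in C)].

(* The whole vertex set is a cover, so the minimum is over a nonempty family. *)
Lemma vertex_coverT (G : sgraph) : vertex_cover [set: G].
Proof. by apply/forallP=> x; apply/forallP=> y; rewrite !inE implybT. Qed.

Definition vertex_cover_number (G : sgraph) : nat :=
  #|[arg min_(C < [set: G] | vertex_cover C) #|C|]|.

Inductive A1_vertex := Aa | Ab | Ac | Ad | Ae | Af | Ag | Ah | Ai | Aj.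

Definition A1_enum := [:: Aa; Ab; Ac; Ad; Ae; Af; Ag; Ah; Ai; Aj].

Definition A1_index (v : A1_vertex) : nat :=
  match v with
  | Aa => 0 | Ab => 1 | Ac => 2 | Ad => 3 | Ae => 4
  | Af => 5 | Ag => 6 | Ah => 7 | Ai => 8 | Aj => 9
  end.

Lemma A1_indexK : cancel A1_index (nth Aa A1_enum). Proof. by case. Qed.

HB.instance Definition _ := Countable.copy A1_vertex (can_type A1_indexK).

Lemma A1_enumP : Finite.axiom A1_enum. Proof. by case. Qed.

HB.instance Definition _ := isFinite.Build A1_vertex A1_enumP.

(* Each undirected edge is listed once, as an ordered pair; it is symmetrized
   in [blanusa1_adj]. *)
Definition A1_edges : seq (A1_vertex * A1_vertex) :=
  [:: (Aa, Af); (Af, Ah); (Ah, Ac); (Ae, Ai); (Ab, Ag); (Ag, Aj); (Aj, Ad);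
      (Aa, Ae); (Ae, Ab); (Af, Ag); (Ah, Ai); (Ai, Aj); (Ac, Ad)].

Inductive L_vertex := Lx | Ly | Lw | Lz | Lu | Lv | Ls | Lt.

Definition L_enum := [:: Lx; Ly; Lw; Lz; Lu; Lv; Ls; Lt].

Definition L_index (v : L_vertex) : nat :=
  match v with
  | Lx => 0 | Ly => 1 | Lw => 2 | Lz => 3
  | Lu => 4 | Lv => 5 | Ls => 6 | Lt => 7
  end.

Lemma L_indexK : cancel L_index (nth Lx L_enum). Proof. by case. Qed.

HB.instance Definition _ := Countable.copy L_vertex (can_type L_indexK).

Lemma L_enumP : Finite.axiom L_enum. Proof. by case. Qed.

HB.instance Definition _ := isFinite.Build L_vertex L_enumP.

Definition L_edges : seq (L_vertex * L_vertex) :=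
  [:: (Lx, Lv); (Lv, Lw); (Lu, Lt); (Ly, Ls); (Ls, Lz);
      (Lx, Lu); (Lu, Ly); (Lv, Ls); (Lw, Lt); (Lt, Lz)].

(* [inr (k, p)] is the vertex p of the (k+1)-st block: blocks are numbered
   from 0 here, so the first one is k = 0 and the last one is k.+1 = i. *)
Definition blanusa1_vertex (i : nat) : finType :=
  (A1_vertex + 'I_i * L_vertex)%type.

Definition blanusa1_arc (i : nat) (p q : blanusa1_vertex i) : bool :=
  match p, q with
  | inl p, inl q => (p, q) \in A1_edges
  | inr (k, p), inr (l, q) =>
      (k == l) && ((p, q) \in L_edges)
      || (k.+1 == l :> nat) && ((p, q) \in [:: (Lz, Lx); (Lw, Ly)])
  | inr (k, p), inl q =>
      (k == 0 :> nat) && ((p, q) \in [:: (Ly, Ac); (Lx, Ad)])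
      || (k.+1 == i) && ((p, q) \in [:: (Lz, Aa); (Lw, Ab)])
  | inl _, inr _ => false
  end.

Definition blanusa1_adj (i : nat) : rel (blanusa1_vertex i) :=
  fun p q => blanusa1_arc p q || blanusa1_arc q p.

Lemma blanusa1_adj_sym (i : nat) : symmetric (@blanusa1_adj i).
Proof. by move=> p q; rewrite /blanusa1_adj orbC. Qed.

Lemma blanusa1_adj_irrefl (i : nat) : irreflexive (@blanusa1_adj i).
Proof.
rewrite /blanusa1_adj => -[p | [k p]]; rewrite orbb /=; first by case: p.
by rewrite eqxx (gtn_eqF (ltnSn k)) orbF; case: p.
Qed.

(* For i = 0, which is not a snark, this is the bare block A_1. *)
Definition blanusa1 (i : nat) : sgraph :=
  SGraph (@blanusa1_adj_sym i) (@blanusa1_adj_irrefl i).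

(* Main.v *)
Require Import Defs.
From mathcomp Require Import all_boot all_order all_algebra.
From mathcomp Require Import zify lra.

(** Call x, y, w, z in each block L_k and a, b, c, d in A_1 the terminals. The
    2(i + 1) edges between blocks form a perfect matching of the terminals, so
    every cover contains at least 2(i + 1) terminals
    ([sum_terminals_of_cover]). On the other hand, a cover that contains t
    terminals of a block has at least (12 + t) / 3 vertices there if the block
    is an L_k ([L_cover_bound]), and at least (15 + t) / 3 if it is A_1
    ([A1_cover_bound]). Adding up, a cover C satisfies
    3 |C| >= 12 i + 15 + 2 (i + 1) = 14 i + 17.

    For the upper bound, fix a cover of A_1 with 6 vertices containing a, b and
    c, and use in the blocks L_k three covers with 5, 4 and 5 vertices in
    cyclic order ([L_optimal_cover]). All four are tight for the block bounds,
    and every edge between blocks has exactly one end in the union D, except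
    that the edges at a and b may have both. So 3 |D| <= 14 i + 17 + 2, which
    leaves only the rounded-up value for |D|, and as a and b are both taken, the
    cyclic order may stop anywhere. *)

Set Implicit Arguments.
Unset Strict Implicit.
Unset Printing Implicit Defensive.

(** * Vertex covers and sums over the blocks *)

Definition covers_edges (T : Type) (E : seq (T * T)) (P : pred T) : bool :=
  all (fun e => P e.1 || P e.2) E.

Lemma vertex_coverP (G : sgraph) (C : {set G}) :
  reflect (forall x y : G, adj x y -> (x \in C) || (y \in C)) (vertex_cover C).
Proof.
apply: (iffP forallP) => [cov x y xy | cov x].
  by move/forallP/(_ y)/implyP: (cov x); apply.
by apply/forallP=> y; apply/implyP; apply: cov.
Qed.

Lemma vertex_cover_number_eq (G : sgraph) (n : nat) (D : {set G}) :
    vertex_cover D -> #|D| = n ->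
    (forall C : {set G}, vertex_cover C -> n <= #|C|) ->
  vertex_cover_number G = n.
Proof.
move=> covD cardD lb; rewrite /vertex_cover_number.
case: arg_minnP => [|C covC minC]; first exact: vertex_coverT.
by apply/eqP; rewrite eqn_leq lb // andbT -cardD minC.
Qed.

Lemma big_A1_vertex (F : A1_vertex -> nat) :
  \sum_v F v = F Aa + F Ab + F Ac + F Ad + F Ae + F Af + F Ag + F Ah + F Ai
               + F Aj.
Proof.
have -> : index_enum A1_vertex = A1_enum by rewrite /index_enum !unlock.
by rewrite !big_cons big_nil addn0 !addnA.
Qed.

Lemma big_L_vertex (F : L_vertex -> nat) :
  \sum_v F v = F Lx + F Ly + F Lw + F Lz + F Lu + F Lv + F Ls + F Lt.
Proof.
have -> : index_enum L_vertex = L_enum by rewrite /index_enum !unlock.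
by rewrite !big_cons big_nil addn0 !addnA.
Qed.

Lemma card_blanusa1_set (i : nat) (C : {set blanusa1 i}) :
  #|C| = \sum_p (inl p \in C) + \sum_k \sum_p (inr (k, p) \in C).
Proof.
by rewrite -sum1_card big_mkcond /= big_sumType /= pair_big; congr (_ + _);
  apply: eq_bigr => -[k p] _ /=.
Qed.

Lemma blanusa1_cover_arcP (i : nat) (C : {set blanusa1 i}) :
  reflect (forall p q : blanusa1_vertex i,
             blanusa1_arc p q -> (p \in C) || (q \in C))
          (vertex_cover C).
Proof.
apply: (iffP (vertex_coverP C)) => cov p q.
  by move=> pq; apply: cov; rewrite /= /blanusa1_adj pq.
by case/orP=> /cov //; rewrite orbC.
Qed.

(** * The lower bound *)

(** In L_k, u, v, t, s is a 4-cycle of which each edge is subdivided by a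
    terminal (x, w, z, y in this order), with the chords vs and ut added. Count
    3 for each of u, v, t, s in a cover and 2 for each terminal in it: the claim
    is that this weight is at least 12. A cover misses at most one end of each
    chord. If it misses none of u, v, t, s, they weigh 12; if it misses just
    one, two terminals are forced: 9 + 4; if it misses one end of each chord,
    these are consecutive on the 4-cycle, hence force three terminals: 6 + 6. *)
Lemma L_cover_bound (P : pred L_vertex) :
    covers_edges L_edges P ->
  12 + (P Lx + P Ly + (P Lw + P Lz)) <= 3 * \sum_v P v.
Proof.
rewrite big_L_vertex /covers_edges /=.
by case: (P Lx) (P Ly) (P Lw) (P Lz) (P Lu) (P Lv) (P Ls) (P Lt)
  => [] [] [] [] [] [] [] [].
Qed.

(** In A_1, the non-terminals are the 5-cycle f, h, i, j, g and the vertex e.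
    With the weight of a cover again 3 for each of these and 2 for each
    terminal, the claim is that it is at least 15. A cover contains three
    vertices of the 5-cycle and one of c, d, which weigh 11 already. If it
    misses e, it contains both a and b: 11 + 4. If it contains e, it weighs 14,
    and one more vertex is needed: if the cover misses f or g, that is a or b;
    if not, then it contains four vertices of the 5-cycle or misses both h and
    j, so that it contains both c and d. *)
Lemma A1_cover_bound (P : pred A1_vertex) :
    covers_edges A1_edges P ->
  15 + (P Aa + P Ab + (P Ac + P Ad)) <= 3 * \sum_v P v.
Proof.
rewrite big_A1_vertex /covers_edges /=.
by case: (P Aa) (P Ab) (P Ac) (P Ad) (P Ae) (P Af) (P Ag) (P Ah) (P Ai) (P Aj)
  => [] [] [] [] [] [] [] [] [] [].
Qed.

Lemma two_edges_cover (p q r s : bool) : p || r -> q || s -> 2 <= p + q + (r + s).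
Proof. by case: p q r s => [] [] [] []. Qed.

(** The sums of the inputs (x, y) and of the outputs (w, z) of the blocks are
    shifted by one block against each other, so that the two terms at each
    junction meet. *)
Lemma sum_terminals_of_cover (n : nat) (C : {set blanusa1 n.+1}) :
    vertex_cover C ->
  2 * n.+2 <=
    (inl Aa \in C) + (inl Ab \in C) + ((inl Ac \in C) + (inl Ad \in C))
    + \sum_k ((inr (k, Lx) \in C) + (inr (k, Ly) \in C)
              + ((inr (k, Lw) \in C) + (inr (k, Lz) \in C))).
Proof.
move/blanusa1_cover_arcP=> cov; rewrite big_split /=.
rewrite [X in _ + (X + _)]big_ord_recl [X in _ + (_ + X)]big_ord_recr /=.
have first_junction : 2 <= (inr (ord0, Lx) \in C) + (inr (ord0, Ly) \in C)
                           + ((inl Ad \in C) + (inl Ac \in C)).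
  by apply: two_edges_cover; apply: cov.
have last_junction : 2 <= (inr (ord_max, Lw) \in C) + (inr (ord_max, Lz) \in C)
                          + ((inl Ab \in C) + (inl Aa \in C)).
  by apply: two_edges_cover; apply: cov; rewrite /= eqxx orbT.
pose inner_in (j : 'I_n) :=
  (inr (lift ord0 j, Lx) \in C) + (inr (lift ord0 j, Ly) \in C).
pose inner_out (j : 'I_n) := (inr (widen_ord (leqnSn n) j, Lw) \in C)
                             + (inr (widen_ord (leqnSn n) j, Lz) \in C).
have inner_junctions : 2 * n <= \sum_j inner_in j + \sum_j inner_out j.
  rewrite -big_split /= mulnC -[X in X * 2]card_ord -sum_nat_const.
  apply: leq_sum => j _; rewrite addnC [inner_in j]addnC.
  by apply: two_edges_cover; apply: cov; rewrite /= eqxx orbT.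
rewrite -/(\sum_j inner_in j) -/(\sum_j inner_out j).
move: inner_junctions first_junction last_junction.
(* As booleans, the memberships would be split into cases. *)
by do 8!move: (nat_of_bool _) => ?; lia.
Qed.

Lemma blanusa1_cover_lower_bound (i : nat) (C : {set blanusa1 i}) :
  0 < i -> vertex_cover C -> 14 * i + 17 <= 3 * #|C|.
Proof.
case: i C => // n C _ covC; have terminals := sum_terminals_of_cover covC.
move/blanusa1_cover_arcP: covC => cov.
have A1_bound : 15 + ((inl Aa \in C) + (inl Ab \in C)
    + ((inl Ac \in C) + (inl Ad \in C))) <= 3 * \sum_p (inl p \in C).
  apply: (A1_cover_bound (P := fun p => inl p \in C)).
  by apply/allP=> -[p q] pq; apply: cov.
have L_bounds : 12 * n.+1 + \sum_k ((inr (k, Lx) \in C) + (inr (k, Ly) \in C)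
    + ((inr (k, Lw) \in C) + (inr (k, Lz) \in C)))
    <= 3 * \sum_k \sum_p (inr (k, p) \in C).
  rewrite mulnC -[X in X * 12]card_ord -sum_nat_const -big_split big_distrr /=.
  apply: leq_sum => k _.
  apply: (L_cover_bound (P := fun p => inr (k, p) \in C)).
  by apply/allP=> -[p q] pq; apply: cov; rewrite /= eqxx pq.
rewrite card_blanusa1_set; move: terminals A1_bound L_bounds.
by do 4!move: (nat_of_bool _) => ?; lia.
Qed.

(** * A cover attaining the bound *)

Definition A1_optimal_cover : seq A1_vertex := [:: Aa; Ab; Ac; Af; Ai; Aj].

(** Three covers for which [L_cover_bound] is an equality; for each of them, the
    outputs that it omits lead to inputs that the next one contains. *)
Definition L_optimal_cover (k : nat) : seq L_vertex :=
  match k %% 3 with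
  | 0 => [:: Lx; Lw; Lz; Lu; Ls]
  | 1 => [:: Lu; Lv; Ls; Lt]
  | _ => [:: Lx; Ly; Lw; Ls; Lt]
  end.

Definition blanusa1_optimal_cover (i : nat) : {set blanusa1 i} :=
  [set p : blanusa1_vertex i | match p with
                               | inl p => p \in A1_optimal_cover
                               | inr (k, p) => p \in L_optimal_cover k
                               end].

Variant mod3_spec (k : nat) : nat -> nat -> Type :=
  | Mod3_0 : mod3_spec k 0 1
  | Mod3_1 : mod3_spec k 1 2
  | Mod3_2 : mod3_spec k 2 0.

Lemma mod3P (k : nat) : mod3_spec k (k %% 3) (k.+1 %% 3).
Proof.
rewrite -[k.+1]addn1 -modnDml.
by have := ltn_pmod k (isT : 0 < 3); case: (k %% 3) => [|[|[|]]] // _; constructor.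
Qed.

Lemma blanusa1_optimal_coverP (i : nat) :
  vertex_cover (blanusa1_optimal_cover i).
Proof.
apply/blanusa1_cover_arcP=> -[p | [k p]] [q | [l q]] //; rewrite !inE.
- by case: p; case: q.
- rewrite /= /L_optimal_cover; case/orP=> /andP[].
    by move/eqP=> ->; case: p; case: q.
  by move=> _; case: p; case: q; rewrite ?orbT.
- rewrite /= /L_optimal_cover; case/orP=> /andP[] /eqP.
    by move=> <-; case: (mod3P k); case: p; case: q.
  by move=> <-; case: (mod3P k); case: p; case: q.
Qed.

Lemma sum_size_L_optimal_cover (i : nat) :
  \sum_(k < i) size (L_optimal_cover k) = 5 * i - i.+1 %/ 3.
Proof.
elim: i => [|i IHi]; first by rewrite big_ord0.
rewrite big_ord_recr /= IHi /L_optimal_cover.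
case Er: (i %% 3) => [|[|r]] /=; lia.
Qed.

Lemma card_blanusa1_optimal_cover (i : nat) :
  #|blanusa1_optimal_cover i| = (14 * i + 19) %/ 3.
Proof.
rewrite card_blanusa1_set.
under [X in _ + X]eq_bigr => k _.
  have -> : \sum_p (inr (k, p) \in blanusa1_optimal_cover i)
            = size (L_optimal_cover k).
    rewrite big_L_vertex !inE /L_optimal_cover.
    by case: (mod3P k).
  over.
rewrite sum_size_L_optimal_cover big_A1_vertex !inE /=.
lia.
Qed.

(** * The ceiling of a third *)

Lemma ceil_natr_div3 (m : nat) :
  (Num.ceil (m%:R / 3%:R : rat) = ((m + 2) %/ 3)%:Z)%R.
Proof.
apply: Num.Theory.ceil_def; set q := (_ %/ 3).
rewrite GRing.rmorphB /= GRing.rmorph1 -pmulrn.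
have le_mq : (m%:R <= (q * 3)%:R :> rat)%R.
  by rewrite Num.Theory.ler_nat /q; lia.
have lt_qm : ((q * 3)%:R < m%:R + 3%:R :> rat)%R.
  by rewrite -GRing.natrD Num.Theory.ltr_nat /q; lia.
move: le_mq lt_qm; rewrite GRing.natrM => le_mq lt_qm.
by apply/andP; split; lra.
Qed.

Theorem theorem23 (i : nat) (hi : 1 <= i) :
  ((vertex_cover_number (blanusa1 i))%:Z
   = Num.ceil ((14 * i + 17)%:R / 3%:R : rat))%R.
Proof.
rewrite ceil_natr_div3 -addnA; congr (Posz _).
apply: vertex_cover_number_eq (blanusa1_optimal_coverP i) _ _.
  exact: card_blanusa1_optimal_cover.
by move=> C /(blanusa1_cover_lower_bound hi); lia.
Qed.
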